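(* Let $m$ and $d$ be integers with $2\le d<m\le 2d-1$, and let $H_{m,d}(x)=\sum_{n=1}^{\infty}h_{m,d}(n)x^n$. Let $T_{m,d}$ be the function analytic on the open disk of radius $m$ about $0$ in $\mathbb{C}$ such that $H_{m,d}(x)=\frac{x}{(x-1)^2}T_{m,d}(x)$ for $|x|<1$. Then the Garsia entropy $\mathfrak{H}_{m,d}$ of the uniform $(m,d)$-measure satisfies $$\mathfrak{H}_{m,d}=\lim_{n\to\infty}\frac{h_{m,d}(n)}{n\log_2 d}=\frac{T_{m,d}(1)}{\log_2 d}.$$
   Context: For integers $2\le d<m\le 2d-1$ let $S_j(x)=\frac{x}{d}+\frac{j}{d}\cdot\frac{d-1}{m-1}$ for $j=0,1,\dots,m-1$. The uniform $(m,d)$-measure is the unique self-similar probability measure $\mu=\sum_{j=0}^{m-1}\frac1m\,\mu\circ S_j^{-1}$. For a word $\sigma=(\sigma_1,\dots,\sigma_n)\in\{0,\dots,m-1\}^n$ of length $|\sigma|=n$ put $S_\sigma=S_{\sigma_1}\circ\cdots\circ S_{\sigma_n}$ (with $S_\emptyset=\mathrm{id}$). The $(m,d)$-graph has as its nodes at level $n\ge 0$ the set $g_n$ of distinct real numbers of the form $S_\sigma(0)$, $|\sigma|=n$; a node $S_\sigma(0)$ at level $n$ is connected to the nodes $S_{\sigma i}(0)$, $i=0,\dots,m-1$, at level $n+1$. For $z\in g_n$, $\mathrm{freq}(z)$ is the number of paths from the root (level $0$) to $z$, equivalently the number of words $\sigma$ with $|\sigma|=n$ and $S_\sigma(0)=z$.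 The entropy of level $n$ is $$h_{m,d}(n)=-\sum_{z\in g_n}\bigl(m^{-n}\mathrm{freq}(z)\bigr)\log_2\bigl(m^{-n}\mathrm{freq}(z)\bigr),$$ and the Garsia entropy of the uniform $(m,d)$-measure is $\mathfrak{H}_{m,d}=\lim_{n\to\infty}\frac{h_{m,d}(n)}{n\log_2 d}$. A function $T_{m,d}$ with the stated properties exists and is unique: it is the analytic extension to the disk of radius $m$ of $\frac{(x-1)^2}{x}H_{m,d}(x)$. *)

(* Defs.v *)
From Stdlib Require Export Reals List.
From Coquelicot Require Export Coquelicot.
Open Scope R_scope.

Definition similarity (m d j : nat) (x : R) : R :=
  x / INR d + INR j / INR d * ((INR d - 1) / (INR m - 1)).

(* Outermost letter first: [w1; ...; wn] acts as S_w1 o ... o S_wn. *)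
Definition similarity_word (m d : nat) (w : list nat) (x : R) : R :=
  fold_right (similarity m d) x w.

Fixpoint words (m n : nat) : list (list nat) :=
  match n with
  | O => nil :: nil
  | S k => flat_map (fun w => map (fun j => j :: w) (seq 0 m)) (words m k)
  end.

(* The values S_w(0), |w| = n, each repeated once per word. *)
Definition word_points (m d n : nat) : list R :=
  map (fun w => similarity_word m d w 0) (words m n).

(* The node set g_n, as a duplicate-free list. *)
Definition nodes (m d n : nat) : list R :=
  nodup Req_dec_T (word_points m d n).

(* Each word of length n is one path from the root, ending at S_w(0). *)
Definition freq (m d n : nat) (z : R) : nat :=
  count_occ Req_dec_T (word_points m d n) z.

Definition log2 (x : R) : R := ln x / ln 2.

Definition node_prob (m d n : nat) (z : R) : R :=
  INR (freq m d n z) / INR m ^ n.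

Definition level_entropy (m d n : nat) : R :=
  - fold_right Rplus 0
      (map (fun z => node_prob m d n z * log2 (node_prob m d n z))
           (nodes m d n)).

(* The value at n = 0 is a division by zero, which does not affect limits. *)
Definition normalized_entropy (m d n : nat) : R :=
  level_entropy m d n / (INR n * log2 (INR d)).

(* Meaningful only once [normalized_entropy m d] is known to converge to a
   finite limit. *)
Definition garsia_entropy (m d : nat) : R :=
  real (Lim_seq (normalized_entropy m d)).

(* Sum of a complex series; convergence in C is componentwise. *)
Definition CSeries (a : nat -> C) : C :=
  (Series (fun n => Re (a n)), Series (fun n => Im (a n))).

(* The sum over n >= 1, reindexed from 0. *)
Definition entropy_gf (m d : nat) (x : C) : C :=
  CSeries (fun n => (RtoC (level_entropy m d (S n)) * x ^ (S n))%C).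

Definition analytic_at (f : C -> C) (z0 : C) : Prop :=
  exists (a : nat -> C) (r : R), 0 < r /\
    forall z : C, Cmod (z - z0)%C < r ->
      @is_pseries C_AbsRing C_NormedModule a (z - z0)%C (f z).

Definition analytic_on_disk (f : C -> C) (rho : R) : Prop :=
  forall z : C, Cmod z < rho -> analytic_at f z.

(* Main.v *)
Require Import Defs.
From Stdlib Require Import Lra Lia.

(** Two facts give the result: [h(n) / n] has a limit [L], and that limit can
    be read off the growth of the generating function as [x] increases to 1.

    The limit exists because the entropy is subadditive. A word of length
    [n + k] is a pair of words of lengths [n] and [k], and
    [S_(wv)(0) = S_w(0) + d ^ - n S_v(0)] ([word_points_add]), so two words
    representing [y] and [z] concatenate to one representing [y + d ^ - n z];
    hence frequencies are supermultiplicative ([freq_supermultiplicative]).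
    Written as an average over all words, the entropy is the mean of
    [- log2 (node_prob)], so the pointwise inequality averages to
    [h(n + k) <= h(n) + h(k)] ([level_entropy_subadditive]), and [fekete]
    applies.

    For real [x] in (0, 1) the functional equation reads
    [T(x) = (1 - x)^2 * sum_n (n + 1) v_n x^n] with
    [v_n = h(n + 1) / (n + 1)]. The weights [(1 - x)^2 (n + 1) x^n] are a
    probability distribution drifting to infinity as [x] tends to 1, so the
    right-hand side tends to [L] ([abel_mean]); the left-hand side tends to
    [T(1)], because [1 < m] puts 1 inside the disk of analyticity
    ([analytic_at_continuous_real]). *)

(** * Sums over lists *)

Definition list_rsum {A : Type} (f : A -> R) (l : list A) : R :=
  fold_right Rplus 0 (map f l).

Lemma list_rsum_app {A : Type} (f : A -> R) (l1 l2 : list A) :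
  list_rsum f (l1 ++ l2) = list_rsum f l1 + list_rsum f l2.
Proof.
  unfold list_rsum; induction l1 as [|a l1 IH]; simpl; [ring|].
  rewrite IH; ring.
Qed.

Lemma list_rsum_map {A B : Type} (f : B -> R) (g : A -> B) (l : list A) :
  list_rsum f (map g l) = list_rsum (fun x => f (g x)) l.
Proof. unfold list_rsum; now rewrite map_map. Qed.

Lemma list_rsum_flat_map {A B : Type} (f : B -> R) (g : A -> list B)
    (l : list A) :
  list_rsum f (flat_map g l) = list_rsum (fun x => list_rsum f (g x)) l.
Proof.
  induction l as [|a l IH]; simpl; [reflexivity|].
  rewrite list_rsum_app, IH; reflexivity.
Qed.

Lemma list_rsum_le {A : Type} (f g : A -> R) (l : list A) :
  (forall x, In x l -> f x <= g x) -> list_rsum f l <= list_rsum g l.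
Proof.
  induction l as [|a l IH]; intros H; [unfold list_rsum; simpl; lra|].
  change (f a + list_rsum f l <= g a + list_rsum g l).
  apply Rplus_le_compat; [apply H; now left|].
  apply IH; intros x Hx; apply H; now right.
Qed.

Lemma list_rsum_ext {A : Type} (f g : A -> R) (l : list A) :
  (forall x, In x l -> f x = g x) -> list_rsum f l = list_rsum g l.
Proof.
  intros H; apply Rle_antisym; apply list_rsum_le; intros x Hx;
    rewrite (H x Hx); lra.
Qed.

Lemma list_rsum_plus {A : Type} (f g : A -> R) (l : list A) :
  list_rsum (fun x => f x + g x) l = list_rsum f l + list_rsum g l.
Proof.
  unfold list_rsum; induction l as [|a l IH]; simpl; [ring|].
  rewrite IH; ring.
Qed.

Lemma list_rsum_scal {A : Type} (c : R) (f : A -> R) (l : list A) :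
  list_rsum (fun x => c * f x) l = c * list_rsum f l.
Proof.
  unfold list_rsum; induction l as [|a l IH]; simpl; [ring|].
  rewrite IH; ring.
Qed.

Lemma list_rsum_const {A : Type} (c : R) (l : list A) :
  list_rsum (fun _ => c) l = INR (length l) * c.
Proof.
  unfold list_rsum; induction l as [|a l IH]; [simpl; ring|].
  change (length (a :: l)) with (S (length l)); rewrite S_INR; simpl.
  rewrite IH; ring.
Qed.

Lemma list_rsum_indicator (a : R) (f : R -> R) (ns : list R) :
  NoDup ns -> In a ns ->
  list_rsum (fun z => if Req_dec_T a z then f z else 0) ns = f a.
Proof.
  induction 1 as [|b ns Hb Hnd IH]; [easy|]; intros Hin.
  change ((if Req_dec_T a b then f b else 0)
          + list_rsum (fun z => if Req_dec_T a z then f z else 0) ns = f a).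
  destruct (Req_dec_T a b) as [e|ne].
  - subst b.
    rewrite (list_rsum_ext _ (fun _ => 0)).
    + rewrite list_rsum_const; ring.
    + intros x Hx; destruct (Req_dec_T a x) as [e|]; [subst; easy|reflexivity].
  - destruct Hin as [e|Hin]; [congruence|].
    rewrite IH by assumption; ring.
Qed.

(** Summing over distinct values weighted by multiplicity is summing over the
    list with repetitions; [ns] is kept separate from [l] so that induction on
    [l] leaves the set of values fixed. *)
Lemma list_rsum_count (f : R -> R) (ns l : list R) :
  NoDup ns -> incl l ns ->
  list_rsum (fun z => INR (count_occ Req_dec_T l z) * f z) ns = list_rsum f l.
Proof.
  intros Hnd; induction l as [|a l IH]; intros Hincl.
  - rewrite (list_rsum_ext _ (fun _ => 0)).
    + rewrite list_rsum_const; unfold list_rsum; simpl; ring.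
    + intros; simpl; ring.
  - change (list_rsum f (a :: l)) with (f a + list_rsum f l).
    rewrite <- IH by (intros x Hx; apply Hincl; now right).
    rewrite <- (list_rsum_indicator a f ns) by (auto; apply Hincl; now left).
    rewrite <- list_rsum_plus; apply list_rsum_ext; intros z _.
    simpl; destruct (Req_dec_T a z); [rewrite S_INR|]; ring.
Qed.

(** * The level points under concatenation of words *)

Lemma word_points_S (m d n : nat) :
  word_points m d (S n) =
  flat_map (fun z => map (fun j => similarity m d j z) (seq 0 m))
    (word_points m d n).
Proof.
  unfold word_points; simpl.
  induction (words m n) as [|w l IH]; simpl; [reflexivity|].
  rewrite map_app, IH, map_map; reflexivity.
Qed.

Lemma map_flat_map {A B C : Type} (f : B -> C) (g : A -> list B) (l : list A) :
  map f (flat_map g l) = flat_map (fun x => map f (g x)) l.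
Proof.
  induction l as [|a l IH]; simpl; [reflexivity|].
  rewrite map_app, IH; reflexivity.
Qed.

Lemma flat_map_flat_map {A B C : Type} (f : B -> list C) (g : A -> list B)
    (l : list A) :
  flat_map f (flat_map g l) = flat_map (fun x => flat_map f (g x)) l.
Proof.
  induction l as [|a l IH]; simpl; [reflexivity|].
  rewrite flat_map_app, IH; reflexivity.
Qed.

Lemma flat_map_map {A B C : Type} (f : B -> list C) (g : A -> B) (l : list A) :
  flat_map f (map g l) = flat_map (fun x => f (g x)) l.
Proof.
  induction l as [|a l IH]; simpl; [reflexivity|].
  rewrite IH; reflexivity.
Qed.

(** [S_w] is affine of slope [d ^ - |w|], so [S_(wv)(0)] is
    [S_w(0) + S_v(0) / d ^ |w|]. *)
Lemma word_points_add (m d n k : nat) :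
  (0 < d)%nat ->
  word_points m d (n + k) =
  flat_map (fun z => map (fun y => y + z / INR d ^ n) (word_points m d n))
    (word_points m d k).
Proof.
  intros Hd.
  assert (Hd0 : INR d <> 0) by (apply not_0_INR; lia).
  induction n as [|n IH].
  - change (word_points m d 0) with (0 :: nil); simpl.
    induction (word_points m d k) as [|a l IHl]; simpl; [reflexivity|].
    rewrite <- IHl; f_equal; field.
  - change (S n + k)%nat with (S (n + k)).
    rewrite word_points_S, IH, flat_map_flat_map.
    apply flat_map_ext; intros z.
    rewrite word_points_S, map_flat_map, flat_map_map.
    apply flat_map_ext; intros y.
    rewrite map_map; apply map_ext; intros j.
    unfold similarity; generalize ((INR d - 1) / (INR m - 1)); intros c.
    simpl; field; split; [apply pow_nonzero|]; assumption.
Qed.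

Lemma length_word_points (m d n : nat) :
  INR (length (word_points m d n)) = INR m ^ n.
Proof.
  induction n as [|n IH]; [reflexivity|].
  rewrite word_points_S, (flat_map_constant_length (c := m)).
  - rewrite mult_INR, IH; simpl; ring.
  - intros; now rewrite length_map, length_seq.
Qed.

Lemma count_occ_translate (c y : R) (l : list R) :
  count_occ Req_dec_T (map (fun x => x + c) l) (y + c) =
  count_occ Req_dec_T l y.
Proof.
  symmetry; apply (count_occ_map (fun x => x + c)).
  intros; lra.
Qed.

Lemma count_occ_flat_map_ge (g : R -> list R) (x z : R) (l : list R) :
  (count_occ Req_dec_T (g z) x * count_occ Req_dec_T l z <=
   count_occ Req_dec_T (flat_map g l) x)%nat.
Proof.
  induction l as [|a l IH]; simpl; [lia|].
  rewrite count_occ_app.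
  destruct (Req_dec_T a z) as [e|ne]; [subst a|]; lia.
Qed.

(** Concatenating a word for [y] with a word for [z] gives a word for the
    combined point, and distinct pairs give distinct words. *)
Lemma freq_supermultiplicative (m d n k : nat) (y z : R) :
  (0 < d)%nat ->
  (freq m d n y * freq m d k z <= freq m d (n + k) (y + z / INR d ^ n))%nat.
Proof.
  intros Hd; unfold freq; rewrite word_points_add by assumption.
  eapply Nat.le_trans; [|apply (count_occ_flat_map_ge _ _ z)].
  cbv beta; rewrite count_occ_translate; lia.
Qed.

(** * Subadditivity of the level entropy *)

Definition information (m d n : nat) (z : R) : R := - log2 (node_prob m d n z).

Lemma log2_le (x y : R) : 0 < x -> x <= y -> log2 x <= log2 y.
Proof.
  intros Hx Hxy; unfold log2, Rdiv.
  apply Rmult_le_compat_r.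
  - left; apply Rinv_0_lt_compat; rewrite <- ln_1; apply ln_increasing; lra.
  - destruct Hxy as [Hxy|Hxy]; [left; apply ln_increasing; lra|].
    rewrite Hxy; lra.
Qed.

Lemma log2_mult (x y : R) :
  0 < x -> 0 < y -> log2 (x * y) = log2 x + log2 y.
Proof.
  intros Hx Hy; unfold log2; rewrite ln_mult by assumption.
  unfold Rdiv; ring.
Qed.

Lemma log2_1 : log2 1 = 0.
Proof. unfold log2; rewrite ln_1; unfold Rdiv; ring. Qed.

Lemma node_prob_pos (m d n : nat) (z : R) :
  (0 < m)%nat -> In z (word_points m d n) -> 0 < node_prob m d n z.
Proof.
  intros Hm Hz; unfold node_prob.
  apply Rdiv_lt_0_compat.
  - apply lt_0_INR; apply (count_occ_In Req_dec_T); assumption.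
  - apply pow_lt, lt_0_INR; assumption.
Qed.

Lemma node_prob_le_1 (m d n : nat) (z : R) :
  (0 < m)%nat -> node_prob m d n z <= 1.
Proof.
  intros Hm; unfold node_prob.
  assert (Hp : 0 < INR m ^ n) by (apply pow_lt, lt_0_INR; assumption).
  apply Rmult_le_reg_r with (INR m ^ n); [assumption|].
  unfold Rdiv; rewrite Rmult_assoc, Rinv_l, Rmult_1_r, Rmult_1_l by lra.
  rewrite <- (length_word_points m d n); apply le_INR, count_occ_bound.
Qed.

Lemma information_subadditive (m d n k : nat) (y z : R) :
  (0 < d)%nat -> (0 < m)%nat ->
  In y (word_points m d n) -> In z (word_points m d k) ->
  information m d (n + k) (y + z / INR d ^ n) <=
  information m d n y + information m d k z.
Proof.
  intros Hd Hm Hy Hz; unfold information.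
  pose proof (node_prob_pos m d n y Hm Hy) as Py.
  pose proof (node_prob_pos m d k z Hm Hz) as Pz.
  assert (H : log2 (node_prob m d n y * node_prob m d k z) <=
              log2 (node_prob m d (n + k) (y + z / INR d ^ n))).
  { apply log2_le; [apply Rmult_lt_0_compat; assumption|].
    assert (Hm0 : 0 < INR m) by (apply lt_0_INR; assumption).
    unfold node_prob; rewrite pow_add.
    replace (INR (freq m d n y) / INR m ^ n * (INR (freq m d k z) / INR m ^ k))
      with (INR (freq m d n y * freq m d k z) / (INR m ^ n * INR m ^ k)).
    - apply Rmult_le_compat_r.
      + left; apply Rinv_0_lt_compat, Rmult_lt_0_compat; apply pow_lt, Hm0.
      + apply le_INR, freq_supermultiplicative; assumption.
    - rewrite mult_INR; field.
      split; apply pow_nonzero; lra. }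
  rewrite log2_mult in H by assumption; lra.
Qed.

(** Grouping equal points turns the average over words into the weighted sum
    over nodes. Averaging over words is what makes the pointwise bound
    [information_subadditive] usable, since words of length [n + k] are exactly
    the pairs of words. *)
Lemma level_entropy_average (m d n : nat) :
  (0 < m)%nat ->
  INR m ^ n * level_entropy m d n =
  list_rsum (information m d n) (word_points m d n).
Proof.
  intros Hm.
  assert (Hp : INR m ^ n <> 0) by (apply pow_nonzero, not_0_INR; lia).
  rewrite <- (list_rsum_count _ (nodes m d n)).
  - unfold level_entropy.
    change (fold_right Rplus 0 (map ?f (nodes m d n)))
      with (list_rsum f (nodes m d n)).
    rewrite <- (Rmult_1_l (list_rsum _ (nodes m d n))) at 1.
    replace (INR m ^ n * - (1 * list_rsum
      (fun z => node_prob m d n z * log2 (node_prob m d n z)) (nodes m d n)))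
      with (- INR m ^ n * list_rsum
      (fun z => node_prob m d n z * log2 (node_prob m d n z)) (nodes m d n))
      by ring.
    rewrite <- list_rsum_scal; apply list_rsum_ext; intros z _.
    unfold information; fold (freq m d n z).
    replace (INR (freq m d n z)) with (INR m ^ n * node_prob m d n z); [ring|].
    unfold node_prob; field; assumption.
  - apply NoDup_nodup.
  - intros x Hx; apply nodup_In; assumption.
Qed.

Lemma level_entropy_nonneg (m d n : nat) :
  (0 < m)%nat -> 0 <= level_entropy m d n.
Proof.
  intros Hm.
  assert (Hp : 0 < INR m ^ n) by (apply pow_lt, lt_0_INR; assumption).
  apply Rmult_le_reg_l with (INR m ^ n); [assumption|].
  rewrite level_entropy_average by assumption; rewrite Rmult_0_r.
  replace 0 with (list_rsum (fun _ : R => 0) (word_points m d n))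
    by (rewrite list_rsum_const; ring).
  apply list_rsum_le; intros z Hz; unfold information.
  assert (log2 (node_prob m d n z) <= log2 1).
  { apply log2_le; [apply node_prob_pos | apply node_prob_le_1]; assumption. }
  rewrite log2_1 in *; lra.
Qed.

Lemma level_entropy_subadditive (m d n k : nat) :
  (0 < d)%nat -> (0 < m)%nat ->
  level_entropy m d (n + k) <= level_entropy m d n + level_entropy m d k.
Proof.
  intros Hd Hm.
  assert (Hp : 0 < INR m ^ (n + k)) by (apply pow_lt, lt_0_INR; assumption).
  apply Rmult_le_reg_l with (INR m ^ (n + k)); [assumption|].
  rewrite level_entropy_average, word_points_add, list_rsum_flat_map
    by assumption.
  apply Rle_trans with
    (list_rsum (fun z => list_rsum (fun y => information m d n y
       + information m d k z) (word_points m d n)) (word_points m d k)).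
  - apply list_rsum_le; intros z Hz; rewrite list_rsum_map.
    apply list_rsum_le; intros y Hy.
    apply information_subadditive; assumption.
  - right.
    rewrite (list_rsum_ext _ (fun z =>
      list_rsum (information m d n) (word_points m d n)
      + INR m ^ n * information m d k z)).
    + rewrite list_rsum_plus, list_rsum_const, list_rsum_scal.
      rewrite <- !level_entropy_average, length_word_points by assumption.
      rewrite pow_add; ring.
    + intros z _; rewrite list_rsum_plus, list_rsum_const, length_word_points.
      reflexivity.
Qed.

(** * Fekete's lemma *)

Lemma subadditive_mult (u : nat -> R) (q k r : nat) :
  (forall n k, u (n + k)%nat <= u n + u k) ->
  u (q * k + r)%nat <= INR q * u k + u r.
Proof.
  intros Hu; induction q as [|q IH]; [simpl; lra|].
  rewrite S_INR; replace (S q * k + r)%nat with (k + (q * k + r))%nat by lia.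
  specialize (Hu k (q * k + r)%nat); lra.
Qed.

(** Dividing [n = q k + r] shows that [u n / n] exceeds [u k / k] by at most
    [O(1/n)] for each fixed [k]; hence the limit is the infimum. *)
Lemma fekete (u : nat -> R) :
  (forall n, 0 <= u n) ->
  (forall n k, u (n + k)%nat <= u n + u k) ->
  exists L : R, is_lim_seq (fun n => u n / INR n) L.
Proof.
  intros Hpos Hu.
  destruct (completeness (fun x => exists k, x = - (u (S k) / INR (S k))))
    as [M [HM1 HM2]].
  - exists 0; intros x [k ->].
    assert (0 <= u (S k) / INR (S k)); [|lra].
    apply Rdiv_le_0_compat; [apply Hpos|apply lt_0_INR; lia].
  - exists (- (u 1%nat / INR 1)); exists 0%nat; reflexivity.
  - (* [M] is the supremum of the opposites, so [- M] is the infimum. *)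
    exists (- M).
    apply is_lim_seq_spec; intros eps; simpl.
    assert (Hk : exists k, u (S k) / INR (S k) < - M + eps / 2).
    { apply Classical_Pred_Type.not_all_not_ex; intros Hno.
      assert (M <= M - eps / 2); [|destruct eps; simpl in *; lra].
      apply HM2; intros x [k ->].
      specialize (Hno k); apply Rnot_lt_le in Hno; lra. }
    destruct Hk as [k Hk].
    (* [c] bounds [u r] for every remainder [r < S k]. *)
    set (c := u 0%nat + INR (S k) * u 1%nat).
    assert (Hc : 0 <= c).
    { apply Rplus_le_le_0_compat; [apply Hpos|].
      apply Rmult_le_pos; [apply pos_INR|apply Hpos]. }
    destruct (nfloor_ex (c / (eps / 2))) as [N [_ HN]].
    { apply Rdiv_le_0_compat; [assumption|destruct eps; simpl; lra]. }
    exists (S N); intros n Hn.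
    assert (Hn0 : 0 < INR n) by (apply lt_0_INR; lia).
    assert (Hlow : - M <= u n / INR n).
    { destruct n as [|n]; [lia|].
      enough (- (u (S n) / INR (S n)) <= M) by lra.
      apply HM1; exists n; reflexivity. }
    assert (Hcn : c / INR n < eps / 2).
    { apply Rmult_lt_reg_r with (INR n); [assumption|].
      unfold Rdiv at 1; rewrite Rmult_assoc, Rinv_l, Rmult_1_r by lra.
      assert (He : 0 < eps / 2) by (destruct eps; simpl; lra).
      apply Rmult_lt_reg_r with (/ (eps / 2)); [now apply Rinv_0_lt_compat|].
      replace (eps / 2 * INR n * / (eps / 2)) with (INR n) by (field; lra).
      apply Rlt_le_trans with (1 := HN).
      rewrite <- S_INR; apply le_INR; assumption. }
    assert (Hup : u n <= INR n * (u (S k) / INR (S k)) + c).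
    { set (q := (n / S k)%nat); set (r := (n mod S k)%nat).
      assert (En : n = (q * S k + r)%nat).
      { unfold q, r; rewrite Nat.mul_comm; apply Nat.div_mod; lia. }
      assert (Hr : (r < S k)%nat) by (apply Nat.mod_upper_bound; lia).
      assert (Hur : u r <= c).
      { apply Rle_trans with (INR r * u 1%nat + u 0%nat).
        - replace r with (r * 1 + 0)%nat at 1 by lia.
          apply subadditive_mult; assumption.
        - unfold c; rewrite Rplus_comm; apply Rplus_le_compat_l.
          apply Rmult_le_compat_r; [apply Hpos|apply le_INR; lia]. }
      assert (Hk0 : 0 < INR (S k)) by (apply lt_0_INR; lia).
      assert (Hq : INR q * u (S k) <= INR n * (u (S k) / INR (S k))).
      { replace (INR q * u (S k)) with
          (INR q * INR (S k) * (u (S k) / INR (S k))) by (field; lra).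
        apply Rmult_le_compat_r.
        - apply Rdiv_le_0_compat; [apply Hpos|assumption].
        - rewrite <- mult_INR; apply le_INR; lia. }
      rewrite En at 1.
      pose proof (subadditive_mult u q (S k) r Hu); lra. }
    assert (Hup' : u n / INR n <= u (S k) / INR (S k) + c / INR n).
    { apply Rmult_le_reg_r with (INR n); [assumption|].
      replace (u n / INR n * INR n) with (u n) by (field; lra).
      replace ((u (S k) / INR (S k) + c / INR n) * INR n)
        with (INR n * (u (S k) / INR (S k)) + c);
        [assumption|field; split; [lra|apply not_0_INR; lia]]. }
    apply Rabs_def1; lra.
Qed.

(** * Power series *)

(** Strictly outside the disk of convergence the terms cannot tend to zero. *)
Lemma ex_pseries_CV_radius_ge (a : nat -> R) (x : R) :
  ex_pseries a x -> Rbar_le (Rabs x) (CV_radius a).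
Proof.
  intros Hx; apply Rbar_not_lt_le; intros Hlt.
  apply (CV_disk_outside a x Hlt), ex_series_lim_0.
  now apply ex_pseries_R.
Qed.

Lemma CV_radius_geom (x : R) :
  Rabs x < 1 -> Rbar_lt (Rabs x) (CV_radius (fun _ => 1)).
Proof.
  intros Hx; pose proof (Rabs_pos x) as Hx0.
  apply Rbar_lt_le_trans with (Rabs ((1 + Rabs x) / 2)).
  - simpl; rewrite (Rabs_right ((1 + Rabs x) / 2)); lra.
  - apply ex_pseries_CV_radius_ge, ex_pseries_R.
    exists (/ (1 - (1 + Rabs x) / 2)).
    apply is_series_ext with (fun n => ((1 + Rabs x) / 2) ^ n);
      [intros; simpl; ring|].
    apply is_series_geom; rewrite Rabs_right; lra.
Qed.

(** The derivative of the geometric series, term by term. *)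
Lemma is_series_derive_geom (x : R) :
  Rabs x < 1 -> is_series (fun n => INR (S n) * x ^ n) (/ (1 - x) ^ 2).
Proof.
  intros Hx; pose proof (CV_radius_geom x Hx) as Hcv.
  assert (Hx1 : x < 1) by (apply Rabs_def2 in Hx; lra).
  assert (Hex : ex_series (fun n => INR (S n) * x ^ n)).
  { pose proof (ex_pseries_derive _ _ Hcv) as H.
    apply ex_pseries_R in H.
    apply ex_series_ext with (2 := H); intros n; unfold PS_derive.
    rewrite Rmult_1_r; reflexivity. }
  replace (/ (1 - x) ^ 2) with (Series (fun n => INR (S n) * x ^ n));
    [now apply Series_correct|].
  transitivity (PSeries (PS_derive (fun _ => 1)) x).
  { unfold PSeries; apply Series_ext; intros n; unfold PS_derive.
    rewrite Rmult_1_r; reflexivity. }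
  rewrite <- (is_derive_unique _ _ _ (is_derive_PSeries _ _ Hcv)).
  apply is_derive_unique.
  apply is_derive_ext_loc with (fun y => / (1 - y)).
  - exists (mkposreal (1 - Rabs x) ltac:(lra)); intros y Hy.
    assert (Hy1 : Rabs y < 1).
    { apply Rabs_def1; unfold ball in Hy; simpl in Hy;
        unfold AbsRing_ball, abs, minus, plus, opp in Hy; simpl in Hy;
        apply Rabs_def2 in Hy; apply Rabs_def2 in Hx;
        unfold Rabs in Hy; destruct (Rcase_abs x); lra. }
    symmetry; unfold PSeries; apply is_series_unique.
    apply is_series_ext with (fun n => y ^ n); [intros; simpl; ring|].
    now apply is_series_geom.
  - auto_derive; [lra|]; field; lra.
Qed.

(** The kernel [(1 - x)^2 (n + 1) x^n] has total mass one on the integers and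
    its mass escapes to infinity as [x] tends to one, so it averages a
    convergent sequence to its limit. If [|v n - L| <= eps] for [n >= N] and
    [|v n - L| <= B] always, then [|v n - L| <= eps + B N / (n + 1)] for all
    [n], which sums in closed form to an error [eps + B N (1 - x)]. *)
Lemma abel_mean (v : nat -> R) (L : R) :
  is_lim_seq v L ->
  filterlim (fun x => (1 - x) ^ 2 * Series (fun n => INR (S n) * v n * x ^ n))
    (at_left 1) (locally L).
Proof.
  intros Hv.
  assert (Hb : exists B, 0 <= B /\ forall n, Rabs (v n - L) <= B).
  { assert (Hcv : ex_finite_lim_seq (fun n => v n - L)).
    { exists (L - L); apply is_lim_seq_minus'; [assumption|].
      apply is_lim_seq_const. }
    destruct (filterlim_bounded (fun n => v n - L)) as [B HB].
    - destruct Hcv as [l Hl]; exists l; exact Hl.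
    - exists B; split; [|exact HB].
      apply Rle_trans with (2 := HB 0%nat); apply Rabs_pos. }
  destruct Hb as [B [HB0 HB]].
  apply is_lim_seq_spec in Hv.
  apply filterlim_locally; intros eps.
  assert (He : 0 < eps / 2) by (destruct eps; simpl; lra).
  destruct (Hv (mkposreal _ He)) as [N HN]; simpl in HN.
  set (K := B * INR N).
  assert (HK : 0 <= K) by (apply Rmult_le_pos; [assumption|apply pos_INR]).
  assert (Hdelta : 0 < Rmin 1 (eps / 2 / (K + 1))).
  { apply Rmin_pos; [lra|]; apply Rdiv_lt_0_compat; lra. }
  exists (mkposreal _ Hdelta); intros x Hx Hx1.
  unfold ball in Hx; simpl in Hx;
    unfold AbsRing_ball, abs, minus, plus, opp in Hx; simpl in Hx.
  apply Rabs_def2 in Hx; destruct Hx as [_ Hx].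
  pose proof (Rmin_l 1 (eps / 2 / (K + 1))) as Hm1.
  pose proof (Rmin_r 1 (eps / 2 / (K + 1))) as Hm2.
  assert (Hx0 : 0 < x) by lra.
  assert (Hxabs : Rabs x < 1) by (rewrite Rabs_right; lra).
  assert (Hsmall : K * (1 - x) < eps / 2).
  { apply Rle_lt_trans with ((K + 1) * (1 - x)).
    - apply Rmult_le_compat_r; lra.
    - replace (pos eps / 2) with ((K + 1) * (eps / 2 / (K + 1)))
        by (field; lra).
      apply Rmult_lt_compat_l; lra. }
  pose proof (is_series_derive_geom x Hxabs) as Hker.
  pose proof (is_series_geom x Hxabs) as Hgeo.
  pose proof (is_series_plus _ _ _ _
    (is_series_scal (eps / 2) _ _ Hker) (is_series_scal K _ _ Hgeo)) as Hmaj.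
  unfold plus, scal in Hmaj; simpl in Hmaj; unfold mult in Hmaj; simpl in Hmaj.
  set (maj := fun n : nat => eps / 2 * (INR (S n) * x ^ n) + K * x ^ n).
  change (is_series maj (eps / 2 * / (1 - x) ^ 2 + K * / (1 - x))) in Hmaj.
  set (err := fun n : nat => INR (S n) * (v n - L) * x ^ n).
  assert (Hle : forall n, 0 <= Rabs (err n) <= maj n).
  { intros n; split; [apply Rabs_pos|].
    assert (Hxn : 0 < x ^ n) by (apply pow_lt; assumption).
    assert (HSn : 0 < INR (S n)) by (apply lt_0_INR; lia).
    unfold err, maj; rewrite !Rabs_mult, (Rabs_right (x ^ n)) by lra.
    rewrite (Rabs_right (INR (S n))) by lra.
    rewrite <- Rmult_assoc, <- Rmult_plus_distr_r.
    apply Rmult_le_compat_r; [lra|].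
    destruct (Nat.le_gt_cases N n) as [HNn|HNn].
    - specialize (HN n HNn).
      rewrite (Rmult_comm (pos eps / 2)).
      apply Rle_trans with (INR (S n) * (eps / 2)); [|lra].
      apply Rmult_le_compat_l; lra.
    - (* here [n + 1 <= N], so [(n + 1) B <= K] *)
      apply Rle_trans with K.
      + unfold K; rewrite (Rmult_comm B).
        apply Rmult_le_compat; [lra|apply Rabs_pos| |apply HB].
        apply le_INR; lia.
      + assert (0 < eps / 2 * INR (S n)) by (apply Rmult_lt_0_compat; lra).
        lra. }
  assert (Hexabs : ex_series (fun n => Rabs (err n))).
  { apply (@ex_series_le R_AbsRing R_CompleteNormedModule _ maj).
    - intros n; unfold norm; simpl; unfold abs; simpl.
      rewrite Rabs_Rabsolu; apply Hle.
    - eexists; exact Hmaj. }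
  assert (Herr : Rabs (Series err) <= eps / 2 * / (1 - x) ^ 2 + K * / (1 - x)).
  { apply Rle_trans with (1 := Series_Rabs _ Hexabs).
    rewrite <- (is_series_unique _ _ Hmaj).
    apply Series_le; [exact Hle|eexists; exact Hmaj]. }
  assert (Hsplit : Series (fun n => INR (S n) * v n * x ^ n) =
                   L * / (1 - x) ^ 2 + Series err).
  { rewrite <- (is_series_unique _ _ Hker), <- Series_scal_l, <- Series_plus.
    - apply Series_ext; intros n; unfold err; ring.
    - apply (@ex_series_scal R_AbsRing R_NormedModule L); eexists; exact Hker.
    - apply ex_series_Rabs; assumption. }
  rewrite Hsplit.
  unfold ball; simpl; unfold AbsRing_ball, abs, minus, plus, opp; simpl.
  replace ((1 - x) * ((1 - x) * 1)) with ((1 - x) ^ 2) by ring.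
  assert (Hsq : 0 < (1 - x) ^ 2) by (apply pow_lt; lra).
  replace ((1 - x) ^ 2 * _ + - L) with ((1 - x) ^ 2 * Series err)
    by (field; lra).
  rewrite Rabs_mult, (Rabs_right ((1 - x) ^ 2)) by lra.
  apply Rle_lt_trans with
    ((1 - x) ^ 2 * (eps / 2 * / (1 - x) ^ 2 + K * / (1 - x))).
  - apply Rmult_le_compat_l; lra.
  - replace ((1 - x) ^ 2 * (eps / 2 * / (1 - x) ^ 2 + K * / (1 - x)))
      with (eps / 2 + K * (1 - x)) by (field; lra).
    lra.
Qed.

(** * Analytic functions restricted to the real line *)

Lemma pow_n_RtoC (t : R) (n : nat) :
  @pow_n C_AbsRing (RtoC t) n = RtoC (t ^ n).
Proof.
  induction n as [|n IH]; [reflexivity|].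
  simpl; rewrite IH; unfold mult; simpl.
  unfold RtoC, Cmult; simpl; f_equal; ring.
Qed.

Lemma sum_n_Re_Im (a : nat -> C) (n : nat) :
  @sum_n C_AbelianMonoid a n =
  (sum_n (fun k => Re (a k)) n, sum_n (fun k => Im (a k)) n).
Proof.
  induction n as [|n IH].
  - rewrite !sum_O; apply surjective_pairing.
  - rewrite !sum_Sn, IH; reflexivity.
Qed.

Lemma is_pseries_Re_Im (a : nat -> C) (t : R) (l : C) :
  @is_pseries C_AbsRing C_NormedModule a (RtoC t) l ->
  is_pseries (fun n => Re (a n)) t (Re l) /\
  is_pseries (fun n => Im (a n)) t (Im l).
Proof.
  intros H.
  assert (Hre : filterlim (fun z : C => Re z) (locally l) (locally (Re l)))
    by exact (continuous_fst (U := R_UniformSpace) (V := R_UniformSpace) (fst l) (snd l)).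
  assert (Him : filterlim (fun z : C => Im z) (locally l) (locally (Im l)))
    by exact (continuous_snd (U := R_UniformSpace) (V := R_UniformSpace) (fst l) (snd l)).
  assert (Hterm : forall n,
    @scal C_AbsRing C_NormedModule (pow_n (RtoC t) n) (a n) =
    (t ^ n * Re (a n), t ^ n * Im (a n))).
  { intros n; rewrite pow_n_RtoC; unfold scal; simpl; unfold mult; simpl.
    unfold RtoC, Cmult, Re, Im; simpl; f_equal; ring. }
  split; apply is_pseries_R; unfold is_series.
  - apply filterlim_ext with (2 := filterlim_comp _ _ _ _ _ _ _ _ H Hre).
    intros n; etransitivity; [apply (f_equal Re), sum_n_Re_Im|]; simpl.
    apply sum_n_ext; intros k.
    etransitivity; [apply (f_equal Re (Hterm k))|]; apply Rmult_comm.
  - apply filterlim_ext with (2 := filterlim_comp _ _ _ _ _ _ _ _ H Him).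
    intros n; etransitivity; [apply (f_equal Im), sum_n_Re_Im|]; simpl.
    apply sum_n_ext; intros k.
    etransitivity; [apply (f_equal Im (Hterm k))|]; apply Rmult_comm.
Qed.

(** Only a real neighbourhood of the centre is used: convergence at
    [x0 + r / 2] already makes the radius of convergence positive. *)
Lemma continuous_of_pseries (a : nat -> R) (g : R -> R) (x0 r : R) :
  0 < r ->
  (forall x, Rabs (x - x0) < r -> is_pseries a (x - x0) (g x)) ->
  continuous g x0.
Proof.
  intros Hr Hg.
  assert (Hcv : Rbar_lt (Rabs 0) (CV_radius a)).
  { apply Rbar_lt_le_trans with (Rabs (r / 2)).
    - simpl; rewrite Rabs_R0; apply Rabs_pos_lt; lra.
    - apply ex_pseries_CV_radius_ge; exists (g (x0 + r / 2)).
      pose proof (Hg (x0 + r / 2)) as H.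
      replace (x0 + r / 2 - x0) with (r / 2) in H by ring.
      apply H; rewrite Rabs_right; lra. }
  apply continuous_ext_loc with (fun x => PSeries a (x - x0)).
  - exists (mkposreal r Hr); intros x Hx.
    apply is_pseries_unique, Hg, Hx.
  - apply (continuous_comp (fun x => x - x0) (PSeries a)).
    + apply (continuous_minus (fun x : R => x) (fun _ => x0));
        [apply continuous_id|apply continuous_const].
    + replace (x0 - x0) with 0 by ring.
      apply (ex_derive_continuous (PSeries a)).
      eexists; apply is_derive_PSeries; assumption.
Qed.

(** By [is_pseries_Re_Im] the real and imaginary parts of a power series,
    evaluated on the real line through its centre, are real power series, whose
    continuity is known. *)
Lemma analytic_at_continuous_real (f : C -> C) (x0 : R) :
  analytic_at f (RtoC x0) ->
  continuous (fun x : R => Re (f (RtoC x))) x0 /\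
  continuous (fun x : R => Im (f (RtoC x))) x0.
Proof.
  intros [a [r [Hr Ha]]].
  assert (H : forall x, Rabs (x - x0) < r ->
    is_pseries (fun n => Re (a n)) (x - x0) (Re (f (RtoC x))) /\
    is_pseries (fun n => Im (a n)) (x - x0) (Im (f (RtoC x)))).
  { intros x Hx; apply is_pseries_Re_Im.
    rewrite RtoC_minus; apply Ha; rewrite <- RtoC_minus, Cmod_R; assumption. }
  split; (eapply continuous_of_pseries; [exact Hr|]);
    intros x Hx; apply H; assumption.
Qed.

(** * The Garsia entropy *)

(** The coefficients are put in the form [(n + 1) v_n] expected by
    [abel_mean]. *)
Lemma entropy_gf_real (m d : nat) (x : R) :
  entropy_gf m d (RtoC x) =
  RtoC (x * Series (fun n =>
    INR (S n) * (level_entropy m d (S n) / INR (S n)) * x ^ n)).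
Proof.
  unfold entropy_gf, CSeries.
  rewrite <- Series_scal_l.
  assert (Hterm : forall n,
    (RtoC (level_entropy m d (S n)) * RtoC x ^ S n)%C =
    RtoC (level_entropy m d (S n) * x ^ S n)).
  { intros n; rewrite <- RtoC_pow, <- RtoC_mult; reflexivity. }
  unfold RtoC at 5; f_equal.
  - apply Series_ext; intros n; rewrite Hterm.
    change (Re (RtoC ?y)) with y; rewrite <- tech_pow_Rmult; field; apply not_0_INR; lia.
  - rewrite (Series_ext _ (fun _ => 0 * 0)).
    + rewrite Series_scal_l; ring.
    + intros n; rewrite Hterm; simpl; ring.
Qed.

Theorem corollary3p5 (m d : nat) (hd : (2 <= d)%nat) (hdm : (d < m)%nat)
    (hm : (m <= 2 * d - 1)%nat)
    (T : C -> C)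
    (hT : analytic_on_disk T (INR m))
    (hH : forall x : C, Cmod x < 1 ->
       entropy_gf m d x = (x / (x - RtoC 1) ^ 2 * T x)%C) :
  is_lim_seq (normalized_entropy m d) (Finite (garsia_entropy m d)) /\
  RtoC (garsia_entropy m d) = (T (RtoC 1) / RtoC (log2 (INR d)))%C.
Proof.
  destruct (fekete (level_entropy m d)) as [L HL].
  { intros n; apply level_entropy_nonneg; lia. }
  { intros n k; apply level_entropy_subadditive; lia. }
  assert (Hlog : 0 < log2 (INR d)).
  { rewrite <- log2_1; unfold log2, Rdiv.
    apply Rmult_lt_compat_r.
    - apply Rinv_0_lt_compat; rewrite <- ln_1; apply ln_increasing; lra.
    - apply ln_increasing; [lra|]; apply (lt_INR 1); lia. }
  assert (Hlim : is_lim_seq (normalized_entropy m d) (L / log2 (INR d))).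
  { apply is_lim_seq_ext with
      (fun n => level_entropy m d n / INR n * / log2 (INR d)).
    - intros n; unfold normalized_entropy, Rdiv; rewrite Rinv_mult; ring.
    - apply (is_lim_seq_scal_r _ (/ log2 (INR d)) L); assumption. }
  assert (Hgarsia : garsia_entropy m d = L / log2 (INR d)).
  { unfold garsia_entropy; rewrite (is_lim_seq_unique _ _ Hlim); reflexivity. }
  rewrite Hgarsia; split; [exact Hlim|].
  set (v := fun n => level_entropy m d (S n) / INR (S n)).
  set (A := fun x => (1 - x) ^ 2 * Series (fun n => INR (S n) * v n * x ^ n)).
  assert (HA : filterlim A (at_left 1) (locally L)).
  { apply abel_mean, (is_lim_seq_incr_1 (fun n => level_entropy m d n / INR n)).
    assumption. }
  assert (HT : forall x, 0 < x < 1 -> T (RtoC x) = RtoC (A x)).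
  { intros x Hx.
    assert (E : entropy_gf m d (RtoC x) =
                (RtoC x / (RtoC x - RtoC 1) ^ 2 * T (RtoC x))%C).
    { apply hH; rewrite Cmod_R, Rabs_right; lra. }
    rewrite entropy_gf_real in E.
    assert (Hx0 : RtoC x <> RtoC 0) by (intros e; apply RtoC_inj in e; lra).
    assert (Hx1 : (RtoC x - RtoC 1)%C <> RtoC 0).
    { rewrite <- RtoC_minus; intros e; apply RtoC_inj in e; lra. }
    replace (T (RtoC x)) with
      ((RtoC x - RtoC 1) ^ 2 / RtoC x *
       (RtoC x / (RtoC x - RtoC 1) ^ 2 * T (RtoC x)))%C
      by (field; split; assumption).
    rewrite <- E; unfold A, v.
    generalize (Series (fun n => INR (S n)
      * (level_entropy m d (S n) / INR (S n)) * x ^ n)); intros s.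
    rewrite !RtoC_mult, RtoC_pow, RtoC_minus; field; assumption. }
  assert (Hloc : at_left 1 (fun x => 0 < x < 1)).
  { exists (mkposreal 1 Rlt_0_1); intros x Hx Hx1.
    unfold ball in Hx; simpl in Hx;
      unfold AbsRing_ball, abs, minus, plus, opp in Hx; simpl in Hx.
    apply Rabs_def2 in Hx; lra. }
  destruct (analytic_at_continuous_real T 1) as [HRe HIm].
  { apply hT; rewrite Cmod_R, Rabs_R1; apply (lt_INR 1); lia. }
  assert (Hleft : filter_le (at_left 1) (locally 1))
    by apply filter_le_within.
  assert (ERe : Re (T (RtoC 1)) = L).
  { apply (filterlim_locally_unique (F := at_left 1) A); [|exact HA].
    apply filterlim_ext_loc with (fun x => Re (T (RtoC x))).
    - apply filter_imp with (2 := Hloc); intros x Hx.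
      rewrite HT by assumption; reflexivity.
    - exact (filterlim_filter_le_1 _ Hleft HRe). }
  assert (EIm : Im (T (RtoC 1)) = 0).
  { apply (filterlim_locally_unique (F := at_left 1) (fun _ => 0));
      [|apply filterlim_const].
    apply filterlim_ext_loc with (fun x => Im (T (RtoC x))).
    - apply filter_imp with (2 := Hloc); intros x Hx.
      rewrite HT by assumption; reflexivity.
    - exact (filterlim_filter_le_1 _ Hleft HIm). }
  replace (T (RtoC 1)) with (RtoC L)
    by (rewrite (surjective_pairing (T (RtoC 1))); unfold Re, Im in *;
        rewrite ERe, EIm; reflexivity).
  apply RtoC_div; lra.
Qed.
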